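(* Let $\mathcal{C}=\{C_1,\dots,C_g\}$ be a cycle system for the matroid $M$, $g=g(M)$. Let $e\in\mathcal{C}_{[g]}\cap C_i$ for some $i$. Let $\mathcal{C}'=\{C_1,\dots,C_{i-1},C_{i+1},\dots,C_g\}$, a cycle system for $M\setminus e$, and, if $e$ is a non-loop, let $\mathcal{C}''=\{C_1\setminus e,\dots,C_g\setminus e\}$, a cycle system for $M/e$. 1. There is an injective mapping of coparking functions $P^*(\mathcal{C}')\hookrightarrow P^*(\mathcal{C})$ given by $$(a_1,\dots,a_{i-1},a_{i+1},\dots,a_g)\mapsto(a_1,\dots,a_{i-1},0,a_{i+1},\dots,a_g).$$ Its image is $\{(a_1,\dots,a_g)\in P^*(\mathcal{C}): a_i=0\}$. If $e$ is a loop, then this mapping is bijective. 2. Suppose $e$ is a non-loop. Then there is an injective mapping of coparking functions $P^*(\mathcal{C}'')\hookrightarrow P^*(\mathcal{C})$ given by $$(a_1,\dots,a_g)\mapsto(a_1,\dots,a_{i-1},a_i+1,a_{i+1},\dots,a_g).$$ Its image is $\{(a_1,\dots,a_g)\in P^*(\mathcal{C}): a_i>0\}$.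
   Context: Matroids are on finite ground sets; $g(M)=|E(M)|-r(M)$ is the corank. $\mathbb{N}$ includes $0$, and $\mathbb{N}^0=\{()\}$. A *cycle* of $M$ is a union of circuits. $M\setminus e$, $M/e$ are deletion and contraction; $C_j\setminus e=C_j\setminus\{e\}$. Unique union: for a family $\mathcal{A}=\{A_1,\dots,A_g\}$ of subsets of a set and $\sigma\subseteq[g]=\{1,\dots,g\}$, $\mathcal{A}_\sigma$ is the set of elements $e\in\bigcup_{i\in\sigma}A_i$ for which there is exactly one $i\in\sigma$ with $e\in A_i$. A *cycle system* for $M$ is a collection $\mathcal{C}=\{C_1,\dots,C_g\}$ of cycles of $M$ with $g=g(M)$ such that for every nonempty $\sigma\subseteq[g]$ the unique union $\mathcal{C}_\sigma$ is dependent in $M$. A *coparking function* with respect to $\mathcal{C}$ is a vector $a=(a_1,\dots,a_g)\in\mathbb{N}^g$ such that for every nonempty $\sigma\subseteq[g]$ there is some $i\in\sigma$ with $a_i<|C_i\cap\mathcal{C}_\sigma|$ (if $g=0$, the only one is $()$). $P^*(\mathcal{C})$ is the set of coparking functions. Coordinates of elements of $P^*(\mathcal{C}')$ are indexed by $[g]\setminus\{i\}$. *)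

(* Defs.v *)
From mathcomp Require Import all_boot.

Set Implicit Arguments.
Unset Strict Implicit.
Unset Printing Implicit Defensive.

(* The ground set is a subset of a fixed finite type, so that M, M \ e and M / e
   are all matroids over the same type. *)
Record matroid (T : finType) := Matroid {
  ground : {set T};
  indep : pred {set T};
  indep_ground : forall I : {set T}, indep I -> I \subset ground;
  indep0 : indep set0;
  indepS : forall I J : {set T}, I \subset J -> indep J -> indep I;
  indep_aug : forall I J : {set T}, indep I -> indep J -> #|I| < #|J| ->
    exists2 x, x \in J :\: I & indep (x |: I)
}.

Section Matroid.
Variable T : finType.
Implicit Types (M : matroid T) (A D I J : {set T}) (e : T).

Definition rank M := \max_(I : {set T} | indep M I) #|I|.

Definition corank M := #|ground M| - rank M.

Definition dependent M D := (D \subset ground M) && ~~ indep M D.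

Definition circuit M D := minset (dependent M) D.

Definition loop M e := circuit M [set e].

Definition cycle M A :=
  exists2 S : {set {set T}}, {in S, forall D, circuit M D} & A = cover S.

Definition del_indep M e : pred {set T} := [pred I : {set T} | (e \notin I) && indep M I].

Lemma del_indep_ground M e I : del_indep M e I -> I \subset ground M :\ e.
Proof. by case/andP=> eI /indep_ground; rewrite subsetD1 eI andbT. Qed.

Lemma del_indep0 M e : del_indep M e set0.
Proof. by rewrite /del_indep /= inE indep0. Qed.

Lemma del_indepS M e I J : I \subset J -> del_indep M e J -> del_indep M e I.
Proof.
move=> sIJ /andP[eJ iJ]; rewrite /del_indep /= (indepS sIJ iJ) andbT.
by apply: contra eJ; apply: (subsetP sIJ).
Qed.

Lemma del_indep_aug M e I J : del_indep M e I -> del_indep M e J ->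
  #|I| < #|J| -> exists2 x, x \in J :\: I & del_indep M e (x |: I).
Proof.
move=> /andP[eI iI] /andP[eJ iJ] /(indep_aug iI iJ)[x xJI ixI].
exists x => //; rewrite /del_indep /= ixI andbT !inE negb_or eI andbT.
by apply: contra eJ => /eqP->; case/setDP: xJI.
Qed.

Definition deletion M e : matroid T :=
  Matroid (@del_indep_ground M e) (del_indep0 M e) (@del_indepS M e)
          (@del_indep_aug M e).

(* Contracting a loop is the same as deleting it.  The second branch also covers
   e outside the ground set, a case in which M / e is M. *)
Definition con_indep M e : pred {set T} :=
  [pred I : {set T} | (e \notin I) &&
    (if indep M [set e] then indep M (e |: I) else indep M I)].

Lemma con_indep_ground M e I : con_indep M e I -> I \subset ground M :\ e.
Proof.
case/andP=> eI; rewrite subsetD1 eI andbT.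
by case: ifP => _ /indep_ground // /subUsetP[].
Qed.

Lemma con_indep0 M e : con_indep M e set0.
Proof. by rewrite /con_indep /= inE setU0 indep0; case: ifP. Qed.

Lemma con_indepS M e I J : I \subset J -> con_indep M e J -> con_indep M e I.
Proof.
move=> sIJ /andP[eJ iJ]; apply/andP; split.
  by apply: contra eJ; apply: (subsetP sIJ).
by move: iJ; case: ifP => _; apply: indepS => //; apply: setUS.
Qed.

Lemma con_indep_aug M e I J : con_indep M e I -> con_indep M e J ->
  #|I| < #|J| -> exists2 x, x \in J :\: I & con_indep M e (x |: I).
Proof.
move=> /andP[eI iI] /andP[eJ iJ] ltIJ; move: iI iJ.
have eN x : x \in J :\: I -> e \notin x |: I.
  case/setDP=> xJ _; rewrite !inE negb_or eI andbT.
  by apply: contra eJ => /eqP->.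
case: ifP => e1 iI iJ; last first.
  have [x xJI ixI] := indep_aug iI iJ ltIJ.
  by exists x => //; rewrite /con_indep /= eN // e1.
have [|x xJI ixI] := indep_aug iI iJ; first by rewrite !cardsU1 eI eJ.
have{} xJI : x \in J :\: I.
  by move: xJI; rewrite !inE negb_or; case: eqP => //=.
by exists x => //; rewrite /con_indep /= eN // e1 setUCA.
Qed.

Definition contraction M e : matroid T :=
  Matroid (@con_indep_ground M e) (con_indep0 M e) (@con_indepS M e)
          (@con_indep_aug M e).

End Matroid.

(* Families are indexed by an arbitrary finite type, so that a family with one
   member removed keeps its original indices. *)
Section CycleSystem.
Variables (T I : finType).
Implicit Types (M : matroid T) (C : I -> {set T}) (s : {set I}).

Definition unique_union C s : {set T} :=
  [set e in \bigcup_(i in s) C i | #|[set i in s | e \in C i]| == 1].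

Definition cycle_system M C :=
  [/\ #|I| = corank M,
      forall i, cycle M (C i)
    & forall s, s != set0 -> dependent M (unique_union C s)].

Definition coparking C : pred {ffun I -> nat} :=
  [pred a : {ffun I -> nat} | [forall s : {set I}, (s != set0) ==>
    [exists i in s, a i < #|C i :&: unique_union C s|]]].

Definition drop_member C (i : I) : {j : I | j != i} -> {set T} :=
  fun j => C (val j).

Definition drop_element C (e : T) : I -> {set T} := fun j => C j :\ e.

End CycleSystem.

Definition insert_zero (I : finType) (i : I) (a : {ffun {j : I | j != i} -> nat})
    : {ffun I -> nat} :=
  [ffun j => if insub j is Some k then a k else 0].

Definition incr_coord (I : finType) (i : I) (a : {ffun I -> nat})
    : {ffun I -> nat} :=
  [ffun j => if j == i then (a j).+1 else a j].

Arguments drop_member {T I} C i _.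
Arguments insert_zero {I} i a.
Arguments incr_coord {I} i a.

Section Mappings.
Variables (X Y : Type) (A : {pred X}) (B : {pred Y}) (f : X -> Y).

Definition injects :=
  {homo f : x / x \in A >-> x \in B} /\ {in A &, injective f}.

Definition image_is := forall y, y \in B <-> exists2 x, x \in A & f x = y.

Definition bijects := injects /\ image_is.

End Mappings.

(* Main.v *)
Require Import Defs.
From mathcomp Require Import all_boot.
(* Makes [cycle] denote [Defs.cycle] again rather than [path.cycle]. *)
Import Defs.

Set Implicit Arguments.
Unset Strict Implicit.
Unset Printing Implicit Defensive.

(** Since [e] lies in [C_i] only, it belongs to every unique union [C_s] with
    [i \in s]; hence the coparking inequalities of the two smaller families are
    those of [C] for [s] avoiding [i], respectively with both sides lowered by
    one at [i].  If [e] is a loop and a coparking function [a] of [C] had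
    [0 < a i], delete successively elements of the unique union of the surviving
    family, each lying in a member [C_j] for which the coparking inequality holds,
    and drop [C_j].  When [j = i] the element can be chosen distinct from [e], so
    that [e] survives as a loop that no member of the family contains; this is
    impossible, as deleting all the way down reaches corank [0]. *)

(** * Cycles, corank and dependence under deletion and contraction *)

Section MatroidTheory.
Variable T : finType.
Implicit Types (M : matroid T) (A D J : {set T}) (e x : T).

Lemma indep_card_rank M J : indep M J -> #|J| <= rank M.
Proof. exact: leq_bigmax_cond. Qed.

Lemma indep_extend M J : indep M J ->
  exists2 B : {set T}, J \subset B & indep M B && (#|B| == rank M).
Proof.
move=> iJ; have [B maxB sJB] := maxset_exists (P := indep M) iJ.
have [iB mB] := maxsetP maxB.
exists B => //; rewrite iB eqn_leq indep_card_rank //=.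
apply/bigmax_leqP=> K iK; rewrite leqNgt; apply/negP=> ltBK.
have [x /setDP[_ xB] ixB] := indep_aug iB iK ltBK.
by move: xB; rewrite -(mB _ ixB (subsetUr _ _)) setU11.
Qed.

Lemma dependent_inhabited M D : dependent M D -> exists x, x \in D.
Proof.
case/andP=> _ nD; apply/set0Pn; apply: contraNneq nD => ->.
exact: indep0.
Qed.

Lemma circuit_dep M D : circuit M D -> dependent M D.
Proof. by case/minsetP. Qed.

Lemma circuit_proper_indep M D J : circuit M D -> J \proper D -> indep M J.
Proof.
case/minsetP=> /andP[gD _] minD /properP[sJD [x xD xJ]].
apply: contraR xJ => nJ.
by rewrite (minD J) // /dependent nJ (subset_trans sJD gD).
Qed.

Lemma loopE M e : loop M e = (e \in ground M) && ~~ indep M [set e].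
Proof.
rewrite -sub1set; apply/idP/idP=> [/circuit_dep // | dep1].
apply/minsetP; split=> // A depA; rewrite subset1 => /orP[/eqP // | /eqP A0].
by case/andP: depA; rewrite A0 indep0.
Qed.

Lemma cycle_ground M A : cycle M A -> A \subset ground M.
Proof.
case=> S circS ->; apply/bigcupsP=> D /circS /circuit_dep.
by case/andP.
Qed.

Lemma cycle_circuit M A x : cycle M A -> x \in A ->
  exists2 D : {set T}, circuit M D & (x \in D) && (D \subset A).
Proof.
case=> S circS -> /bigcupP[D DS xD]; exists D; first exact: circS.
by rewrite xD bigcup_sup.
Qed.

Lemma coverP_cycle M A :
  (forall x, x \in A ->
     exists2 D : {set T}, circuit M D & (x \in D) && (D \subset A)) ->
  cycle M A.
Proof.
move=> coverA; exists [set D : {set T} | circuit M D && (D \subset A)].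
  by move=> D; rewrite inE => /andP[].
apply/eqP; rewrite eqEsubset; apply/andP; split.
  apply/subsetP=> x /coverA[D cD /andP[xD sDA]].
  by apply/bigcupP; exists D; rewrite // inE cD.
by apply/bigcupsP=> D; rewrite inE => /andP[].
Qed.

Lemma deletion_dependent M e D :
  e \notin D -> dependent (deletion M e) D = dependent M D.
Proof. by move=> eD; rewrite /dependent /= /del_indep /= subsetD1 eD andbT. Qed.

Lemma deletion_circuit M e D :
  e \notin D -> circuit M D -> circuit (deletion M e) D.
Proof.
move=> eD /minsetP[depD minD]; apply/minsetP.
split=> [|A depA sAD]; first by rewrite deletion_dependent.
apply: minD => //; rewrite -(@deletion_dependent _ e) //.
by apply: contra eD; apply: (subsetP sAD).
Qed.

Lemma deletion_cycle M e A : e \notin A -> cycle M A -> cycle (deletion M e) A.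
Proof.
move=> eA cA; apply: coverP_cycle => x xA.
have [D cD /andP[xD sDA]] := cycle_circuit cA xA; exists D; last by rewrite xD.
by apply: deletion_circuit cD; apply: contra eA; apply: (subsetP sDA).
Qed.

Lemma deletion_loop M e x : x != e -> loop M x -> loop (deletion M e) x.
Proof. by move=> xe; apply: deletion_circuit; rewrite inE eq_sym. Qed.

(** The independent set [D :\ e] extends to a basis, which misses [e] because it cannot contain all
    of [D]; so some basis survives the deletion. *)
Lemma circuit_deletion_rank M e D :
  circuit M D -> e \in D -> rank (deletion M e) = rank M.
Proof.
move=> cD eD; apply/eqP; rewrite eqn_leq; apply/andP; split.
  by apply/bigmax_leqP=> J /andP[_]; apply: indep_card_rank.
have iDe := circuit_proper_indep cD (properD1 eD).
have [B sDB /andP[iB /eqP<-]] := indep_extend iDe.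
apply: (@indep_card_rank (deletion M e)); rewrite /= /del_indep /= iB andbT.
apply/negP=> eB; have /andP[_ /negP[]] := circuit_dep cD.
by apply: indepS iB; rewrite -(setD1K eD) subUset sub1set eB.
Qed.

Lemma circuit_deletion_corank M e D :
  circuit M D -> e \in D -> corank (deletion M e) = (corank M).-1.
Proof.
move=> cD eD; have /andP[/subsetP/(_ _ eD) eM _] := circuit_dep cD.
by rewrite /corank (circuit_deletion_rank cD eD) /= (cardsD1 e (ground M)) eM
           subSKn.
Qed.

(** Adding [e] to a basis of the contraction gives a basis of [M], so the rank and the ground set
    both lose one. *)
Lemma contraction_corank M e : indep M [set e] ->
  corank (contraction M e) = corank M.
Proof.
move=> ie; have eM : e \in ground M by rewrite -sub1set (indep_ground ie).
suff rM : rank M = (rank (contraction M e)).+1.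
  by rewrite /corank rM (cardsD1 e (ground M)) eM.
apply/eqP; rewrite eqn_leq; apply/andP; split.
  have [B sB /andP[iB /eqP<-]] := indep_extend ie; rewrite sub1set in sB.
  rewrite (cardsD1 e B) sB ltnS (@indep_card_rank (contraction M e)) //=.
  by rewrite /con_indep /= !inE eqxx ie setD1K.
have [B _ /andP[/andP[eB]]] := indep_extend (indep0 (contraction M e)).
rewrite ie => iB /eqP<-.
by have := indep_card_rank iB; rewrite cardsU1 eB.
Qed.

Lemma contraction_dependent M e D : indep M [set e] -> dependent M D ->
  dependent (contraction M e) (D :\ e).
Proof.
move=> ie /andP[gD nD]; rewrite /dependent setSD //=.
rewrite /con_indep /= ie negb_and; apply/orP; right; apply: contra nD.
apply: indepS; apply/subsetP=> x xD; rewrite !inE xD andbT.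
by case: (x == e).
Qed.

(** When [e] is outside [D], the set [D] may split into several circuits of the contraction, so one
    is needed through each [x]. It is found inside [x |: J], dependent in the contraction, with [J]
    independent there: such a circuit must contain [x]. *)
Lemma contraction_circuit M e D x : indep M [set e] -> circuit M D ->
    x \in D -> x != e ->
  exists2 Z : {set T}, circuit (contraction M e) Z
    & (x \in Z) && (Z \subset D :\ e).
Proof.
move=> ie cD xD xe; have /andP[gD nD] := circuit_dep cD.
have iDx := circuit_proper_indep cD (properD1 xD).
(* A maximal set [J] of this kind spans [D :\ x], hence [x], in [M / e]. *)
pose P := [pred J : {set T} | (J \subset D :\ x :\ e) && indep M (e |: J)].
have P0 : P set0 by rewrite /= sub0set setU0.
have [J /maxsetP[/andP[sJ iJ] maxJ] _] := maxset_exists P0.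
have [sJDx eJ] := subsetD1P sJ.
have [sJD xJ] := subsetD1P sJDx.
have niJ : ~~ indep M (e |: (x |: J)).
  apply/negP=> ixJ.
  have leDJ : #|D :\ x| <= #|e |: J|.
    rewrite leqNgt; apply/negP=> /(indep_aug iJ iDx)[y yD iy].
    have{yD} [yD yeJ] := setDP yD; move: yeJ; rewrite !inE negb_or.
    case/andP=> ye /negP[]; rewrite -(maxJ (y |: J)) ?setU11 ?subsetUr //=.
    by rewrite setUCA iy subUset sub1set in_setD1 ye yD sJ.
  have ltDJ : #|D :\ x| < #|e |: (x |: J)|.
    apply: leq_ltn_trans leDJ _; apply: proper_card.
    rewrite setUCA properUr // sub1set !inE negb_or xe.
    exact: xJ.
  (* No choice of [z] is possible: [z = e] makes [D :\ x] itself admissible, so it equals [J] and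
     [D] would be independent; [z = x] makes [D] independent at once; and [J] already lies in
     [D :\ x]. *)
  have [z /setDP[zexJ zDx] izD] := indep_aug iDx ixJ ltDJ.
  have [ze|zxJ] := setU1P zexJ.
    rewrite {}ze in zDx izD.
    have DxE : D :\ x = J.
      apply: maxJ => //; rewrite /= izD andbT subsetD1 zDx andbT.
      exact: subxx.
    case/negP: nD; apply: indepS ixJ.
    by rewrite -DxE setD1K // subsetUr.
  have [zx|zJ] := setU1P zxJ; first by rewrite zx setD1K // (negPf nD) in izD.
  by rewrite (subsetP sJDx) in zDx.
have exJ : e \notin x |: J by rewrite !inE negb_or eq_sym xe.
have sxJ : x |: J \subset D by rewrite subUset sub1set xD.
have dxJ : dependent (contraction M e) (x |: J).
  rewrite /dependent /= subsetD1 exJ (subset_trans sxJ gD) /=.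
  by rewrite /con_indep /= ie negb_and niJ orbT.
have [Z cZ sZ] := minset_exists dxJ.
exists Z; first exact: cZ.
have sZD : Z \subset D :\ e.
  by rewrite (subset_trans sZ) // subsetD1 sxJ.
rewrite sZD andbT; apply: contraT => xZ.
have /andP[_ /negP[]] := circuit_dep cZ.
apply: (@indepS _ (contraction M e) Z J); last by rewrite /= /con_indep /= eJ ie.
by rewrite -(setU1K xJ) subsetD1 sZ.
Qed.

Lemma contraction_cycle M e A : indep M [set e] -> cycle M A ->
  cycle (contraction M e) (A :\ e).
Proof.
move=> ie cA; apply: coverP_cycle => x /setD1P[xe xA].
have [D cD /andP[xD sDA]] := cycle_circuit cA xA.
have [Z cZ /andP[xZ sZ]] := contraction_circuit ie cD xD xe.
by exists Z; rewrite // xZ (subset_trans sZ) // setSD.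
Qed.

Lemma corank0_loopless M e : corank M = 0 -> ~~ loop M e.
Proof.
move/eqP; rewrite subn_eq0 => leMr; rewrite loopE negb_and negbK -implybE.
have [B _ /andP[iB /eqP rB]] := indep_extend (indep0 M).
have BM : B = ground M by apply/eqP; rewrite eqEcard indep_ground //= rB.
by apply/implyP=> eM; apply: indepS iB; rewrite sub1set BM.
Qed.

End MatroidTheory.

(** * Membership in unique unions and the coparking condition *)

Section FamilyMembership.
Variables (T I : finType).
Implicit Types (C : I -> {set T}) (s : {set I}) (i : I) (x : T).

Lemma in_unique_union C s x :
  (x \in unique_union C s) = (#|[set i in s | x \in C i]| == 1).
Proof.
rewrite inE andb_idl // => /cards1P[i Ei].
have := set11 i; rewrite -Ei inE => /andP[si xi].
by apply/bigcupP; exists i.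
Qed.

Lemma coparkingP C (a : {ffun I -> nat}) :
  reflect (forall s, s != set0 ->
             exists2 i, i \in s & a i < #|C i :&: unique_union C s|)
          (a \in coparking C).
Proof.
apply: (iffP forallP) => [aC s s0 | aC s]; last first.
  by apply/implyP=> /aC[i si lti]; apply/existsP; exists i; rewrite si.
by have /implyP/(_ s0)/existsP[i /andP[]] := aC s; exists i.
Qed.

End FamilyMembership.

(** * Families with an element in a single member, and the two coordinate maps *)

Section Families.
Variables (T I : finType).
Implicit Types (C : I -> {set T}) (s : {set I}) (i j : I) (x e : T).

(** The hypothesis on [e] as a rewriting rule, settling its membership in every member at once. *)
Definition private C i e := forall j, (e \in C j) = (j == i).

Lemma privateP C i e :
  e \in unique_union C [set: I] :&: C i <-> private C i e.
Proof.
rewrite inE in_unique_union; split=> [/andP[/cards1P[k Ek] ei] j | pe].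
  have Ek' l : (e \in C l) = (l == k).
    by rewrite -[RHS]in_set1 -Ek !inE.
  by move: ei; rewrite !Ek' => /eqP->.
rewrite pe eqxx andbT; apply/cards1P; exists i; apply/setP=> j.
by rewrite !inE pe.
Qed.

Lemma private_unique_union C s i e :
  private C i e -> (e \in unique_union C s) = (i \in s).
Proof.
move=> pe; rewrite in_unique_union.
have -> : [set j in s | e \in C j] = [set i] :&: s.
  by apply/setP=> j; rewrite !inE pe andbC.
case: (boolP (i \in s)) => si.
  by rewrite (setIidPl _) ?sub1set ?cards1.
by rewrite (disjoint_setI0 _) ?cards0 // disjoints1.
Qed.

Lemma unique_union_drop_member C i (s : {set {j : I | j != i}}) :
  unique_union (drop_member C i) s = unique_union C [set val j | j in s].
Proof.
apply/setP=> x; rewrite !in_unique_union.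
rewrite -(card_imset [set j in s | x \in drop_member C i j] val_inj).
congr (#|pred_of_set _| == 1); apply/setP=> j; rewrite inE.
apply/imsetP/andP=> [[k]|[/imsetP[k ks ->] xk]].
  by rewrite inE => /andP[ks xk] ->; split; first exact: imset_f.
by exists k; rewrite // inE ks.
Qed.

Lemma unique_union_drop_element C e s :
  unique_union (drop_element C e) s = unique_union C s :\ e.
Proof.
apply/setP=> x; rewrite in_setD1 !in_unique_union.
have [->|xe] /= := eqVneq x e.
  rewrite (_ : [set j in s | _] = set0) ?cards0 //.
  by apply/setP=> j; rewrite !inE eqxx andbF.
by congr (#|pred_of_set _| == 1); apply/setP=> j; rewrite !inE xe.
Qed.

Lemma imset_val_subset i s : i \notin s ->
  exists s' : {set {j : I | j != i}}, s = [set val j | j in s'].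
Proof.
move=> si; exists [set j | val j \in s]; apply/setP=> j.
apply/idP/imsetP=> [sj|[k]]; last by rewrite inE => ? ->.
have ji : j != i by apply: contraNneq si => <-.
by exists (Sub j ji); rewrite ?inE ?SubK.
Qed.

Definition drop_coord i (a : {ffun I -> nat}) : {ffun {j : I | j != i} -> nat} :=
  [ffun j => a (val j)].

(** The conditions for the reduced family are those of [C] at index sets avoiding [i], so a
    coordinate of any value may be forgotten. The induction on loops relies on this. *)
Lemma drop_coord_coparking C i (a : {ffun I -> nat}) :
  a \in coparking C -> drop_coord i a \in coparking (drop_member C i).
Proof.
move/coparkingP=> aC; apply/coparkingP=> s s0.
have [|j /imsetP[k ks ->] ltk] := aC [set val j | j in s].
  by rewrite imset_eq0.
by exists k; rewrite // ffunE unique_union_drop_member.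
Qed.

Lemma insert_zeroK i : cancel (insert_zero i) (drop_coord i).
Proof. by move=> a; apply/ffunP=> j; rewrite !ffunE valK. Qed.

Lemma insert_zero_at i a : insert_zero i a i = 0.
Proof. by rewrite ffunE insubF ?eqxx. Qed.

Lemma drop_coordK i (a : {ffun I -> nat}) :
  a i = 0 -> insert_zero i (drop_coord i a) = a.
Proof.
move=> ai; apply/ffunP=> j; have [->|ji] := eqVneq j i.
  by rewrite insert_zero_at.
by rewrite ffunE insubT ffunE.
Qed.

Lemma insert_zero_coparking C i e a : private C i e ->
  (insert_zero i a \in coparking C) = (a \in coparking (drop_member C i)).
Proof.
move=> pe; apply/idP/idP=> [/drop_coord_coparking-/(_ i)|].
  by rewrite insert_zeroK.
move/coparkingP=> aC; apply/coparkingP=> s s0.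
have [si|si] := boolP (i \in s).
  (* The inserted coordinate is 0, so one common element of [C i] and the unique union suffices, and
     [e] is one. *)
  exists i => //; rewrite insert_zero_at card_gt0; apply/set0Pn; exists e.
  by rewrite inE pe eqxx (private_unique_union _ pe).
have [s' Es'] := imset_val_subset si.
have [|k ks ltk] := aC s'; first by move: s0; rewrite Es' imset_eq0.
exists (val k); first by rewrite Es' imset_f.
by rewrite Es' -unique_union_drop_member ffunE valK.
Qed.

Lemma incr_coord_lt C i e s j (a : {ffun I -> nat}) : private C i e -> j \in s ->
  (incr_coord i a j < #|C j :&: unique_union C s|)
  = (a j < #|drop_element C e j :&: unique_union (drop_element C e) s|).
Proof.
move=> pe js; rewrite unique_union_drop_element -setDIl ffunE.
(* Counted apart, [e] contributes one exactly when [j = i], which matches the successor on the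
   left. *)
rewrite (cardsD1 e (C j :&: _)) inE pe (private_unique_union _ pe).
by have [<-|_] := eqVneq j i; rewrite ?js.
Qed.

Lemma incr_coord_coparking C i e a : private C i e ->
  (incr_coord i a \in coparking C) = (a \in coparking (drop_element C e)).
Proof.
move=> pe; apply: eq_forallb => s; congr (_ ==> _); apply: eq_existsb => j.
by case: (boolP (j \in s)) => //= js; rewrite (incr_coord_lt _ pe js).
Qed.

Lemma incr_coord_inj i : injective (incr_coord i).
Proof.
move=> a b /ffunP Eab; apply/ffunP=> j; have := Eab j.
by rewrite !ffunE; case: ifP => // _ [].
Qed.

Lemma incr_coord_pred i (a : {ffun I -> nat}) : 0 < a i ->
  incr_coord i [ffun j => if j == i then (a j).-1 else a j] = a.
Proof.
move=> ai; apply/ffunP=> j; rewrite !ffunE.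
by have [->|//] := eqVneq j i; rewrite prednK.
Qed.

End Families.

(** * Cycle systems of minors, and loops *)

Lemma card_sig_neq (I : finType) (i : I) : #|{: {j : I | j != i}}| < #|I|.
Proof. by rewrite card_sig cardC1 ltn_predL; apply/card_gt0P; exists i. Qed.

Lemma deletion_cycle_system (T I : finType) (M : matroid T) (C : I -> {set T})
    (i : I) (e : T) : cycle_system M C -> private C i e ->
  cycle_system (deletion M e) (drop_member C i).
Proof.
move=> [cardI cycC depC] pe.
have eCi : e \in C i by rewrite pe.
split=> [|j|s s0].
(* A circuit through [e] makes the deletion lower the corank by one, in step with the loss of the
   index [i]. *)
- have [D cD /andP[eD _]] := cycle_circuit (cycC i) eCi.
  by rewrite (circuit_deletion_corank cD eD) -cardI card_sig cardC1.
- by apply: deletion_cycle (cycC _); rewrite pe (valP j).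
rewrite unique_union_drop_member deletion_dependent ?depC ?imset_eq0 //.
rewrite (private_unique_union _ pe); apply/imsetP=> -[j _ ij].
by have := valP j; rewrite -ij eqxx.
Qed.

Lemma contraction_cycle_system (T I : finType) (M : matroid T)
    (C : I -> {set T}) (e : T) : cycle_system M C -> indep M [set e] ->
  cycle_system (contraction M e) (drop_element C e).
Proof.
move=> [cardI cycC depC] ie; split=> [|j|s s0].
- by rewrite contraction_corank.
- exact: contraction_cycle.
by rewrite unique_union_drop_element contraction_dependent ?depC.
Qed.

(** The unique union of a nonempty family is dependent, hence inhabited; deleting one of its
    elements other than [e] keeps [e] a loop and shortens the family. An empty family means corank
    0, where no loop exists. *)
Lemma cycle_system_loop (T I : finType) (M : matroid T) (C : I -> {set T})
    (e : T) : cycle_system M C -> loop M e -> exists i, e \in C i.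
Proof.
(* Dropping a member changes the index type, so the induction bounds its cardinality and generalizes
   over it. *)
have [n] := ubnP #|I|; elim: n => // n IHn in I M C * => ltIn sysC le.
have [cardI _ depC] := sysC.
have [I0|/set0Pn[k _]] := eqVneq [set: I] set0.
  have := @corank0_loopless _ M e.
  by rewrite -cardI -cardsT I0 cards0 le => /(_ erefl).
have [|f fU] := dependent_inhabited (depC [set: I] _).
  by apply/set0Pn; exists k.
have /bigcupP[j _ fj] : f \in \bigcup_(i in [set: I]) C i.
  by move: fU; rewrite inE => /andP[].
have /privateP pf : f \in unique_union C [set: I] :&: C j by rewrite inE fU.
have [->|ef] := eqVneq e f; first by exists j.
have [|i ei] := IHn _ _ _ _ (deletion_cycle_system sysC pf) (deletion_loop ef le).
  exact: leq_trans (card_sig_neq j) ltIn.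
by exists (val i).
Qed.

Lemma coparking_loop (T I : finType) (M : matroid T) (C : I -> {set T})
    (i : I) (e : T) (a : {ffun I -> nat}) :
  cycle_system M C -> private C i e -> loop M e -> a \in coparking C ->
  a i = 0.
Proof.
have [n] := ubnP #|I|; elim: n => // n IHn in I M C i a *.
move=> ltIn sysC pe le aC.
have [|j _ ltj] := coparkingP _ _ aC [set: I].
  by apply/set0Pn; exists i.
have [Eji|ji] := eqVneq j i; last first.
  (* The strict inequality at [j] supplies an element private to [C j], which differs from [e]
     because [e] is private to [C i]. *)
  have [f] : exists f, f \in C j :&: unique_union C [set: I].
    by apply/card_gt0P; apply: leq_ltn_trans ltj.
  rewrite setIC => /privateP pf; have ij : i != j by rewrite eq_sym.
  have ef : e != f.
    by apply: contraNneq ij => Eef; rewrite -pf -Eef pe.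
  have pe' : private (drop_member C j) (Sub i ij) e by move=> k; rewrite [LHS]pe.
  have := IHn _ _ _ _ _ (leq_trans (card_sig_neq j) ltIn)
            (deletion_cycle_system sysC pf) pe' (deletion_loop ef le)
            (drop_coord_coparking j aC).
  by rewrite ffunE.
rewrite {j}Eji in ltj; apply/eqP; apply: contraT; rewrite -lt0n => ai.
(* As [0 < a i], the inequality at [i] forces at least two elements in the intersection, so one of
   them is not [e]. *)
have [f] : exists f, f \in (C i :&: unique_union C [set: I]) :\ e.
  apply/card_gt0P; have := leq_ltn_trans ai ltj; rewrite (cardsD1 e).
  by case: (e \in _) => // /ltnW.
rewrite in_setD1 setIC eq_sym => /andP[ef /privateP pf].
have [j] := cycle_system_loop (deletion_cycle_system sysC pf) (deletion_loop ef le).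
by rewrite [_ \in _]pe (negPf (valP j)).
Qed.

Theorem proposition4p4 (T : finType) (M : matroid T) (g : nat)
    (C : 'I_g -> {set T}) (i : 'I_g) (e : T) :
  cycle_system M C ->
  e \in unique_union C [set: 'I_g] :&: C i ->
  [/\ cycle_system (deletion M e) (drop_member C i),
      injects (coparking (drop_member C i)) (coparking C)
        (insert_zero i),
      image_is (coparking (drop_member C i))
        [pred a in coparking C | a i == 0] (insert_zero i)
    & loop M e ->
      bijects (coparking (drop_member C i)) (coparking C)
        (insert_zero i)]
  /\
  (~~ loop M e ->
   [/\ cycle_system (contraction M e) (drop_element C e),
       injects (coparking (drop_element C e)) (coparking C) (incr_coord i)
     & image_is (coparking (drop_element C e))
         [pred a in coparking C | 0 < a i] (incr_coord i)]).
Proof.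
move=> sysC /privateP pe.
have inj0 : injects (coparking (drop_member C i)) (coparking C) (insert_zero i).
  split=> [a aC|]; first by rewrite (insert_zero_coparking _ pe).
  by apply: in2W; apply: can_inj (@insert_zeroK _ i).
have im0 : image_is (coparking (drop_member C i))
             [pred a in coparking C | a i == 0] (insert_zero i).
  move=> a; rewrite inE; split=> [/andP[aC /eqP ai]|[b bC <-]].
    by exists (drop_coord i a); [apply: drop_coord_coparking | apply: drop_coordK].
  by rewrite (insert_zero_coparking _ pe) bC insert_zero_at.
split=> [|nle].
  split=> //; first exact: deletion_cycle_system.
  (* For a loop every coparking function vanishes at [i], so the image described by [im0] is
     everything. *)
  move=> le; split=> // a; apply: iff_trans (im0 a); split=> [aC|/andP[] //].
  by apply/andP; rewrite (coparking_loop sysC pe le aC).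
have ie : indep M [set e].
  (* Not being a loop gives independence only inside the ground set, where [e] lies because it
     belongs to the cycle [C i]. *)
  move: nle; rewrite loopE (subsetP (cycle_ground _) _ (_ : e \in C i)) ?negbK //.
    by case: sysC.
  by rewrite pe.
split; first exact: contraction_cycle_system.
  split=> [a aC|]; first by rewrite (incr_coord_coparking _ pe).
  by apply: in2W; apply: incr_coord_inj.
move=> a; rewrite inE; split=> [/andP[aC ai]|[b bC <-]].
  exists [ffun j => if j == i then (a j).-1 else a j]; last exact: incr_coord_pred.
  by rewrite -(incr_coord_coparking _ pe) incr_coord_pred.
by rewrite (incr_coord_coparking _ pe) bC ffunE eqxx.
Qed.
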